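(* Let $\mathcal G$ be a $2$-step solvable $\mathrm{MD}_{n-2}(n)$-algebra with $n=\dim\mathcal G\ge6$. Then $\mathcal G\cong\mathbb R\oplus\mathfrak s_{5,45}$ (in particular $n=6$), where $\mathfrak s_{5,45}$ is the Lie algebra with basis $\{x_1,x_2,y_1,y_2,z\}$ and nonzero brackets $[x_1,y_1]=y_1$, $[x_1,y_2]=y_2$, $[x_1,z]=2z$, $[x_2,y_1]=y_2$, $[x_2,y_2]=-y_1$, $[y_1,y_2]=z$.
   Context: All Lie algebras are finite-dimensional over $\mathbb R$. $\mathcal G^0=\mathcal G$, $\mathcal G^i=[\mathcal G^{i-1},\mathcal G^{i-1}]$; $\mathcal G$ is $2$-step solvable if $\mathcal G^2$ is commutative and nonzero. An $\mathrm{MD}_k(n)$-algebra is an $n$-dimensional real solvable Lie algebra all of whose non-trivial coadjoint orbits (for its connected simply connected Lie group; $\dim\Omega_F=\operatorname{rank}(F([x_i,x_j]))$ for a basis $\{x_i\}$, non-trivial iff $F|_{\mathcal G^1}\ne0$) have dimension $k$. $\mathbb R\oplus\mathfrak s_{5,45}$ is the Lie algebra direct sum with a $1$-dimensional abelian algebra. *)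

(* Defs.v *)
From HB Require Import structures.
From mathcomp Require Import all_boot all_order all_algebra.
Set Implicit Arguments. Unset Strict Implicit. Unset Printing Implicit Defensive.
Import Order.TTheory GRing.Theory Num.Theory.
Local Open Scope ring_scope.

Section LieDefs.
Variable R : fieldType.

Definition is_lie (n : nat) (br : 'rV[R]_n -> 'rV[R]_n -> 'rV[R]_n) : Prop :=
  (forall (a : R) (u v w : 'rV[R]_n), br (a *: u + v) w = a *: br u w + br v w) /\
  (forall (a : R) (u v w : 'rV[R]_n), br w (a *: u + v) = a *: br w u + br w v) /\
  (forall u : 'rV[R]_n, br u u = 0) /\
  (forall u v w : 'rV[R]_n, br u (br v w) + br v (br w u) + br w (br u v) = 0).

(* [V, V] for a subspace V (given by the row space of a square matrix):
   span of the brackets of the spanning vectors of V (= span of all [x,y],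
   x,y in V, by bilinearity). *)
Definition derived (n : nat) (br : 'rV[R]_n -> 'rV[R]_n -> 'rV[R]_n)
  (V : 'M[R]_n) : 'M[R]_n :=
  (\sum_(i < n) \sum_(j < n) <<br (row i V) (row j V)>>)%MS.

Definition dseries (n : nat) (br : 'rV[R]_n -> 'rV[R]_n -> 'rV[R]_n) (k : nat)
  : 'M[R]_n := iter k (derived br) 1%:M.

Definition lie_solvable (n : nat) (br : 'rV[R]_n -> 'rV[R]_n -> 'rV[R]_n) : Prop :=
  exists k, dseries br k = 0.

Definition commutative_sub (n : nat) (br : 'rV[R]_n -> 'rV[R]_n -> 'rV[R]_n)
  (V : 'M[R]_n) : Prop :=
  forall u v : 'rV[R]_n, (u <= V)%MS -> (v <= V)%MS -> br u v = 0.

Definition two_step_solvable (n : nat) (br : 'rV[R]_n -> 'rV[R]_n -> 'rV[R]_n)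
  : Prop := dseries br 2 != 0 /\ commutative_sub br (dseries br 2).

(* A linear functional F on R^n is represented by f : 'cV_n, F v = (v *m f) 0 0.
   dim Omega_F = rank (F([e_i, e_j]))_{i,j}; Omega_F nontrivial iff F|_{G^1} <> 0. *)
Definition orbit_matrix (n : nat) (br : 'rV[R]_n -> 'rV[R]_n -> 'rV[R]_n)
  (f : 'cV[R]_n) : 'M[R]_n :=
  \matrix_(i < n, j < n) (br (delta_mx 0 i) (delta_mx 0 j) *m f) 0 0.

Definition coadj_orbit_dim (n : nat) (br : 'rV[R]_n -> 'rV[R]_n -> 'rV[R]_n)
  (f : 'cV[R]_n) : nat := \rank (orbit_matrix br f).

Definition nontrivial_orbit (n : nat) (br : 'rV[R]_n -> 'rV[R]_n -> 'rV[R]_n)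
  (f : 'cV[R]_n) : bool := dseries br 1 *m f != 0.

Definition is_MD (k n : nat) (br : 'rV[R]_n -> 'rV[R]_n -> 'rV[R]_n) : Prop :=
  lie_solvable br /\
  forall f : 'cV[R]_n, nontrivial_orbit br f -> coadj_orbit_dim br f = k.

Definition lie_isomorphic (n m : nat) (br1 : 'rV[R]_n -> 'rV[R]_n -> 'rV[R]_n)
  (br2 : 'rV[R]_m -> 'rV[R]_m -> 'rV[R]_m) : Prop :=
  exists P : 'M[R]_(n, m), [/\ row_free P, row_full P &
    forall u v : 'rV[R]_n, br1 u v *m P = br2 (u *m P) (v *m P)].

Definition lie_sum_R (m : nat) (br : 'rV[R]_m -> 'rV[R]_m -> 'rV[R]_m)
  (u v : 'rV[R]_(1 + m)) : 'rV[R]_(1 + m) :=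
  row_mx 0 (br (rsubmx u) (rsubmx v)).

Definition bracket_of (m : nat) (c : 'I_m -> 'I_m -> 'rV[R]_m)
  (u v : 'rV[R]_m) : 'rV[R]_m :=
  \sum_(i < m) \sum_(j < m) (u 0 i * v 0 j) *: c i j.

(* s_{5,45}: basis x1,x2,y1,y2,z = e_0,...,e_4 *)
Definition e5 (k : nat) : 'rV[R]_5 := delta_mx 0 (inord k).

Definition s545_const (i j : 'I_5) : 'rV[R]_5 :=
  match nat_of_ord i, nat_of_ord j with
  | 0, 2 => e5 2        | 2, 0 => - e5 2
  | 0, 3 => e5 3        | 3, 0 => - e5 3
  | 0, 4 => 2 *: e5 4   | 4, 0 => - (2 *: e5 4)
  | 1, 2 => e5 3        | 2, 1 => - e5 3
  | 1, 3 => - e5 2      | 3, 1 => e5 2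
  | 2, 3 => e5 4        | 3, 2 => - e5 4
  | _, _ => 0
  end.

Definition s545 : 'rV[R]_5 -> 'rV[R]_5 -> 'rV[R]_5 := bracket_of s545_const.

End LieDefs.

(* Main.v *)
(**
  Write N = G^1, A = G^2.  A functional vanishing on A but not on N has a
  2-dimensional radical containing A, so dim A <= 2.  The commuting operators
  induced by G on N/A are so nearly transitive on the dual of N/A that a common
  complex eigenvector forces dim N/A <= 2.  If dim A = 2, some x acts on N/A as
  the identity; the operators by which N acts on A are then singular and
  traceless, which is incompatible with [N, N] = A.  Hence dim A = 1, and N is
  the Heisenberg algebra.  Its centralizer C has codimension at most 4 and,
  since [G, C] is contained in A, it lies in the radical of every functional
  vanishing on A; so dim C = 2 and n = 6.  The induced operators on N/A now form
  a copy of the complex numbers, and their generators 1 and i lift to x_1 and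
  x_2 after corrections by elements of N, while C is spanned by A and a central
  element.
*)
Require Import Defs.
From HB Require Import structures.
From mathcomp Require Import all_boot all_order all_algebra.
From mathcomp Require Import reals complex zify ring lra.
Set Implicit Arguments. Unset Strict Implicit. Unset Printing Implicit Defensive.
Import Order.TTheory GRing.Theory Num.Theory.
Local Open Scope ring_scope.

(** * Commuting families of real operators *)

(** [a] and [b] are the real and imaginary parts of a common complex eigenvector, and [s], [t] those
    of its eigenvalue; the transposes turn row eigenvectors into column eigenvectors. *)
Lemma common_eigenplane (R : rcfType) (n p : nat) (M : 'I_n -> 'M[R]_p) :
  (0 < p)%N -> (forall i j, M i *m M j = M j *m M i) ->
  exists a b : 'cV[R]_p, (a != 0) || (b != 0) /\
    forall i, exists s t : R,
      M i *m a = s *: a - t *: b /\ M i *m b = t *: a + s *: b.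
Proof.
move=> p_gt0 Mcomm.
pose toC := real_complex R.
pose Ms := [seq map_mx toC (M i)^T | i <- enum 'I_n].
have [|v v0 /allP vM] := @common_eigenvector _ _ Ms p_gt0.
  move=> _ _ /mapP[i _ ->] /mapP[j _ ->].
  by rewrite /comm_mx -!map_mxM -!trmx_mul Mcomm.
pose a := map_mx (@complex.Re R) v^T; pose b := map_mx (@complex.Im R) v^T.
exists a, b; split.
  rewrite -negb_and; apply: contra v0 => /andP[/eqP a0 /eqP b0].
  apply/eqP/rowP => i; move/colP/(_ i): a0; move/colP/(_ i): b0.
  by rewrite !mxE; case: (v 0 i) => x y /= -> ->.
move=> i; have /sub_rVP[[s t] eM] : (v *m map_mx toC (M i)^T <= v)%MS.
  exact: (vM _ (map_f _ (mem_enum _ i))).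
have ReM (z : R[i]) r : complex.Re (z * toC r) = r * complex.Re z.
  by case: z => x y /=; ring.
have ImM (z : R[i]) r : complex.Im (z * toC r) = r * complex.Im z.
  by case: z => x y /=; ring.
have ReS (u : 'I_p -> R[i]) : complex.Re (\sum_j u j) = \sum_j complex.Re (u j).
  by apply: (big_morph (@complex.Re R) (id1 := 0)) => // -[? ?] [? ?].
have ImS (u : 'I_p -> R[i]) : complex.Im (\sum_j u j) = \sum_j complex.Im (u j).
  by apply: (big_morph (@complex.Im R) (id1 := 0)) => // -[? ?] [? ?].
exists s, t; split; apply/colP => k; move/rowP/(_ k): eM; rewrite !mxE.
  move/(congr1 (@complex.Re R)); rewrite ReS => E.
  transitivity (complex.Re ((s +i* t)%C * v 0 k)); last by case: (v 0 k).
  by rewrite -E; apply: eq_bigr => j _; rewrite !mxE ReM.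
move/(congr1 (@complex.Im R)); rewrite ImS => E.
transitivity (complex.Im ((s +i* t)%C * v 0 k)).
  by rewrite -E; apply: eq_bigr => j _; rewrite !mxE ImM.
by case: (v 0 k) => x y /=; rewrite addrC.
Qed.

(** The hypothesis says that the vectors [M i *m f] span a subspace of codimension at most 1. For a
    real common eigenvector this span is at most a line, so [p <= 2]. In general the span of [a] and
    [b] is stable, hence of codimension at most 1, and only [p = 3] with a nonreal eigenvalue needs
    more work. *)
Lemma commuting_corank_le1_size (R : rcfType) (n p : nat) (M : 'I_n -> 'M[R]_p) :
  (forall i j, M i *m M j = M j *m M i) ->
  (forall f : 'cV[R]_p, f != 0 -> forall C : 'M[R]_p,
     (forall i, C *m (M i *m f) = 0) -> (\rank C <= 1)%N) ->
  (p <= 2)%N.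
Proof.
move=> Mcomm corank; case: (posnP p) => [-> // | p_gt0].
have [a [b [ab0 Mab]]] := common_eigenplane p_gt0 Mcomm.
have eig (f : 'cV[R]_p) :
    f != 0 -> (forall i, exists s, M i *m f = s *: f) -> (p <= 2)%N.
  move=> f0 eigf; have := corank f f0 (kermx f).
  rewrite mxrank_ker; have := rank_leq_col f => rf H.
  suff: (p - \rank f <= 1)%N by lia.
  apply: H => i; have [s ->] := eigf i.
  by rewrite -scalemxAr mulmx_ker scaler0.
pose E := row_mx a b.
have Ea (C : 'M_p) : C *m E = 0 -> C *m a = 0 /\ C *m b = 0.
  by rewrite mul_mx_row -[0]row_mx0 => /eq_row_mx.
have pE : (p - \rank E <= 1)%N.
  have [kA kB] := Ea _ (mulmx_ker E); rewrite -mxrank_ker.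
  have kM i : kermx E *m (M i *m a) = 0 /\ kermx E *m (M i *m b) = 0.
    have [s [t [-> ->]]] := Mab i.
    by rewrite mulmxBr mulmxDr -!scalemxAr kA kB !scaler0 subr0 addr0.
  by case/orP: ab0 => /corank; apply => i; case: (kM i).
have [rE | rE] := leqP (\rank E) 1; first by lia.
have [-> // | p3] : p = 2%N \/ p = 3%N.
  have : (p <= 3)%N by have := rank_leq_col E; lia.
  have := rank_leq_row E; lia.
have a0 : a != 0.
  apply: contraTneq rE => a0; rewrite /E a0 rank_row_0mx -leqNgt.
  exact: rank_leq_col.
case: (boolP [forall i, (M i *m a)^T <= a^T]%MS) => [/forallP aM | ].
  apply: (eig a a0) => i; have /sub_rVP[s] := aM i.
  by rewrite -linearZ => /trmx_inj; exists s.
rewrite negb_forall => /existsP[i0]; have [s [t [Ma Mb]]] := Mab i0.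
have [t0 | t0 _] := eqVneq t 0.
  by rewrite Ma t0 scale0r subr0 linearZ scalemx_sub.
(* The [i0]-th operator acts on the plane by a nonreal scalar, whose real
   quadratic [Q] kills the plane; in dimension 3 the image of [Q] is then a line
   stable under all the operators. *)
pose B := M i0 - s%:M; pose Q := B *m B + (t ^+ 2)%:M.
have QM i : Q *m M i = M i *m Q.
  have BM : B *m M i = M i *m B.
    by rewrite mulmxBl mulmxBr Mcomm mul_scalar_mx mul_mx_scalar.
  rewrite /Q mulmxDl mulmxDr mul_scalar_mx mul_mx_scalar; congr (_ + _).
  by rewrite -mulmxA BM mulmxA BM mulmxA.
have Ba : B *m a = - t *: b by rewrite mulmxBl Ma mul_scalar_mx addrAC subrr add0r scaleNr.
have Bb : B *m b = t *: a by rewrite mulmxBl Mb mul_scalar_mx addrK.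
have QE : Q *m E = 0.
  have QC v : Q *m v = B *m (B *m v) + t ^+ 2 *: v.
    by rewrite /Q mulmxDl mul_scalar_mx -mulmxA.
  rewrite mul_mx_row !QC Ba Bb -!scalemxAr Ba Bb !scalerA.
  by rewrite !mulrN !mulNr !scaleNr -expr2 !addNr row_mx0.
have rQ : (\rank Q <= 1)%N by have := mulmx0_rank_max QE; lia.
(* In odd dimension no real operator has square [- t ^+ 2]: the square of its determinant would be
   negative. *)
have Q0 : Q != 0.
  apply/eqP => /(canRL (addrK _)); rewrite sub0r -scalemx1 -scaleNr scalemx1.
  move=> /(congr1 determinant); rewrite det_mulmx det_scalar.
  have -> : (- t ^+ 2) ^+ p = - (t ^+ 3) ^+ 2 by rewrite p3; ring.
  move=> detB.
  suff: (t ^+ 3) ^+ 2 > 0 by have := sqr_ge0 (\det B); nra.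
  by rewrite exprn_even_gt0 //= expf_neq0.
have /matrix0Pn[i1 [j1 Qij]] := Q0.
pose g := col j1 Q.
have gE : g = Q *m delta_mx j1 0 by rewrite -colE.
have g_neq0 : g != 0 by apply/matrix0Pn; exists i1, 0; rewrite mxE.
have rg : (Q^T <= g^T)%MS.
  have gQ : (g^T <= Q^T)%MS by rewrite gE trmx_mul submxMl.
  rewrite -(geq_leqif (mxrank_leqif_sup gQ)) !mxrank_tr (leq_trans rQ) //.
  by rewrite lt0n mxrank_eq0.
have kQ : kermx g *m Q = 0.
  move/submxP: rg => [D /(congr1 trmx)]; rewrite trmxK trmx_mul trmxK => ->.
  by rewrite mulmxA mulmx_ker mul0mx.
have := corank g g_neq0 (kermx g); rewrite mxrank_ker => H.
suff: (p - \rank g <= 1)%N by have := rank_leq_col g; lia.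
by apply: H => i; rewrite {2}gE [M i *m _]mulmxA -QM -mulmxA mulmxA kQ mul0mx.
Qed.

(** * Two-by-two matrices *)

Lemma ord2P (P : 'I_2 -> Prop) : P 0 -> P 1 -> forall i, P i.
Proof.
move=> P0 P1 [[|[|//]] lt_i2]; first by have -> : Ordinal lt_i2 = 0 by apply: val_inj.
by have -> : Ordinal lt_i2 = 1 by apply: val_inj.
Qed.

Lemma sum_ord2 (V : nmodType) (F : 'I_2 -> V) : \sum_i F i = F 0 + F 1.
Proof. by rewrite big_ord_recl big_ord1; congr (_ + F _); apply: val_inj. Qed.

Lemma det_mx2 (R : comNzRingType) (A : 'M[R]_2) :
  \det A = A 0 0 * A 1 1 - A 0 1 * A 1 0.
Proof.
rewrite (expand_det_row _ 0) !big_ord_recl big_ord0 /cofactor !det_mx11 !mxE.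
have -> : lift 0 (0 : 'I_1) = 1 :> 'I_2 by apply: val_inj.
have -> : lift 1 (0 : 'I_1) = 0 :> 'I_2 by apply: val_inj.
by rewrite /= /bump /=; ring.
Qed.

(** The form [x * x + y * z] is minus the determinant of a traceless matrix, and the third equation
    is its polarization. A suitable combination of the three equations is the perfect square of
    [y * x' - y' * x]. *)
Lemma isotropic_dependent (R : fieldType) (x y z x' y' z' : R) :
  x * x + y * z = 0 -> x' * x' + y' * z' = 0 ->
  x * x' *+ 2 + y * z' + y' * z = 0 -> y != 0 ->
  y * x' = y' * x /\ y * z' = y' * z.
Proof.
move=> q q' b y0.
have xE : y * x' - y' * x = 0.
  apply/eqP; rewrite -sqrf_eq0; apply/eqP.
  transitivity (y ^+ 2 * (x' * x' + y' * z') + y' ^+ 2 * (x * x + y * z)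
    - y * y' * (x * x' *+ 2 + y * z' + y' * z)); first by ring.
  by rewrite q q' b !mulr0 subr0 addr0.
split; apply/subr0_eq => //; apply: (mulfI y0); rewrite mulr0.
transitivity (y * (x * x' *+ 2 + y * z' + y' * z) - 2 * y' * (x * x + y * z)
  - 2 * x * (y * x' - y' * x)); first by ring.
by rewrite q b xE !mulr0 !subr0.
Qed.

(* Traceless singular 2x2 matrices form the isotropic cone of a nondegenerate
   ternary form, whose totally isotropic subspaces are lines. *)
Lemma traceless_singular_dependent (R : fieldType) (S T : 'M[R]_2) :
  \tr S = 0 -> \tr T = 0 -> (forall a b, a *: S + b *: T \notin unitmx) ->
  exists2 u : 'rV[R]_2, u != 0 & u 0 0 *: S + u 0 1 *: T = 0.
Proof.
move=> trS trT ST.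
have S11 : S 1 1 = - S 0 0.
  by move: trS; rewrite /mxtrace sum_ord2 addrC => /eqP; rewrite addr_eq0 => /eqP.
have T11 : T 1 1 = - T 0 0.
  by move: trT; rewrite /mxtrace sum_ord2 addrC => /eqP; rewrite addr_eq0 => /eqP.
have det0 a b : \det (a *: S + b *: T) = 0.
  by apply/eqP; rewrite -[_ == 0]negbK -unitfE; apply: ST.
have := det0 1 1; have := det0 1 0; have := det0 0 1.
rewrite !det_mx2 !mxE S11 T11.
set x := S 0 0; set y := S 0 1; set z := S 1 0.
set x' := T 0 0; set y' := T 0 1; set z' := T 1 0 => q' q b.
have {}q' : x' * x' + y' * z' = 0 by apply/eqP; rewrite -oppr_eq0 -q'; apply/eqP; ring.
have {}q : x * x + y * z = 0 by apply/eqP; rewrite -oppr_eq0 -q; apply/eqP; ring.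
have {}b : x * x' *+ 2 + y * z' + y' * z = 0.
  apply/eqP; rewrite -oppr_eq0; apply/eqP.
  rewrite -[RHS]b -[LHS]subr0 -{1}q -[LHS]subr0 -{1}q'; ring.
pose v (s t : R) : 'rV_2 := \row_i (if i == 0 then s else t).
have [vE0 vE1] : (forall s t, v s t 0 0 = s) /\ (forall s t, v s t 0 1 = t).
  by split=> s t; rewrite mxE.
suff [s [t [st0 xE yE zE]]] : exists s t, [/\ (s != 0) || (t != 0),
    s * x + t * x' = 0, s * y + t * y' = 0 & s * z + t * z' = 0].
  exists (v s t).
    apply: contraTneq st0 => /rowP st; have := st 0; have := st 1.
    by rewrite vE0 vE1 !mxE => -> ->; rewrite eqxx.
  rewrite vE0 vE1; apply/matrixP; apply: ord2P; apply: ord2P; rewrite !mxE //.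
  by rewrite S11 T11 -/x -/x' !mulrN -opprD xE oppr0.
have [y0 | y0] := eqVneq y 0; last first.
  have [xE zE] := isotropic_dependent q q' b y0.
  exists (- y'), y; rewrite y0 orbT; split=> //; rewrite ?xE ?zE; ring.
have [z0 | z0] := eqVneq z 0; last first.
  have [|||xE yE] := @isotropic_dependent _ x z y x' z' y' _ _ _ z0.
  - by rewrite mulrC -[RHS]q; ring.
  - by rewrite mulrC -[RHS]q'; ring.
  - by rewrite -[RHS]b; ring.
  exists (- z'), z; rewrite z0 orbT; split=> //; rewrite ?xE ?yE; ring.
have x0 : x = 0 by apply/eqP; move/eqP: q; rewrite y0 mul0r addr0 mulf_eq0 orbb.
by exists 1, 0; rewrite oner_eq0 x0 y0 z0; split=> //; ring.
Qed.

(** Modulo scalars a matrix is given by its two off-diagonal entries and the difference of its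
    diagonal ones. Commutation says that the triples of [S] and [T] have zero cross product, and the
    triple of a nonscalar [S] is nonzero. *)
Lemma commuting_mx2 (R : fieldType) (S T : 'M[R]_2) :
  ~~ is_scalar_mx S -> S *m T = T *m S -> exists a b, T = a%:M + b *: S.
Proof.
move=> nS ST.
have H i j : (S *m T) i j = (T *m S) i j by rewrite ST.
have H00 := H 0 0; have H01 := H 0 1; have H10 := H 1 0.
rewrite !mxE !sum_ord2 in H00 H01 H10.
have D00 : S 0 1 * T 1 0 = T 0 1 * S 1 0.
  by apply: (addrI (S 0 0 * T 0 0)); rewrite H00 mulrC.
have D01 : S 0 1 * (T 0 0 - T 1 1) = T 0 1 * (S 0 0 - S 1 1).
  by rewrite !mulrBr [T 0 1 * S 1 1](canRL (addKr _) (esym H01)); ring.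
have D10 : S 1 0 * (T 0 0 - T 1 1) = T 1 0 * (S 0 0 - S 1 1).
  by rewrite !mulrBr [S 1 0 * T 0 0](canRL (addrK _) H10); ring.
suff [b [E00 E01 E10]] : exists b, [/\ T 0 0 - T 1 1 = b * (S 0 0 - S 1 1),
    T 0 1 = b * S 0 1 & T 1 0 = b * S 1 0].
  exists (T 1 1 - b * S 1 1), b.
  have T00 : T 0 0 = T 1 1 + b * (S 0 0 - S 1 1) by rewrite -E00; ring.
  apply/matrixP; apply: ord2P; apply: ord2P; rewrite !mxE ?T00 ?E01 ?E10 ?eqxx /=; ring.
have [q0 | q0] := eqVneq (S 0 1) 0; last first.
  exists (T 0 1 / S 0 1); split; apply: (mulfI q0); rewrite [RHS]mulrA mulrCA mulfV // mulr1 //.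
  by rewrite mulrC.
have [r0 | r0] := eqVneq (S 1 0) 0; last first.
  exists (T 1 0 / S 1 0); split; apply: (mulfI r0); rewrite [RHS]mulrA mulrCA mulfV // mulr1 //.
    by rewrite mulrC -D00 mulrC.
  by rewrite mulrC.
have s0 : S 0 0 - S 1 1 != 0.
  apply: contra nS => /eqP/subr0_eq S01; apply/is_scalar_mxP; exists (S 0 0).
  by apply/matrixP; apply: ord2P; apply: ord2P; rewrite !mxE.
exists ((T 0 0 - T 1 1) / (S 0 0 - S 1 1)); rewrite q0 r0 !mulr0; split; first by rewrite mulfVK.
  by apply: (mulIf s0); rewrite -D01 q0 !mul0r.
by apply: (mulIf s0); rewrite -D10 r0 !mul0r.
Qed.

Lemma traceless_mx2_sqr (R : comNzRingType) (S : 'M[R]_2) : S 1 1 = - S 0 0 ->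
  S *m S = (S 0 0 ^+ 2 + S 0 1 * S 1 0)%:M.
Proof.
move=> S11; apply/matrixP; apply: ord2P; apply: ord2P;
  rewrite !mxE sum_ord2 ?S11 ?eqxx /=; ring.
Qed.

(** The column is chosen orthogonal to the first row of [S - c%:M]; the condition on [c ^+ 2] is the
    vanishing of the determinant, which takes care of the second row. *)
Lemma traceless_mx2_eigen (R : comNzRingType) (S : 'M[R]_2) (c : R) :
  S 1 1 = - S 0 0 -> c ^+ 2 = S 0 0 ^+ 2 + S 0 1 * S 1 0 ->
  (S - c%:M) *m (\col_i (if i == 0 then S 0 1 else c - S 0 0)) = 0.
Proof.
move=> S11 cc; apply/colP; apply: ord2P; rewrite !mxE sum_ord2 !mxE ?eqxx /= ?S11.
  by ring.
transitivity (S 0 0 ^+ 2 + S 0 1 * S 1 0 - c ^+ 2); [ring | by rewrite cc subrr].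
Qed.

(** * Brackets, adjoint operators and the derived series *)

Section LieAlgebra.
Variables (R : fieldType) (n : nat) (br : 'rV[R]_n -> 'rV[R]_n -> 'rV[R]_n).
Hypothesis br_lie : is_lie br.
Implicit Types (x y u v : 'rV[R]_n) (V U : 'M[R]_n).

Lemma brxx u : br u u = 0. Proof. by have [_ [_ []]] := br_lie. Qed.

Lemma brDl u v w : br (u + v) w = br u w + br v w.
Proof. by have [Hl _] := br_lie; rewrite -[u]scale1r Hl !scale1r. Qed.

Lemma brDr w u v : br w (u + v) = br w u + br w v.
Proof. by have [_ [Hr _]] := br_lie; rewrite -[u]scale1r Hr !scale1r. Qed.

Lemma brC u v : br u v = - br v u.
Proof.
apply/eqP; rewrite -addr_eq0; apply/eqP.
by have := brxx (u + v); rewrite brDl !brDr !brxx addr0 add0r.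
Qed.

Lemma br0r u : br u 0 = 0.
Proof. by apply/(@addrI _ (br u 0)); rewrite -brDr !addr0. Qed.

Lemma br0l u : br 0 u = 0. Proof. by rewrite brC br0r oppr0. Qed.

Lemma brZl a u w : br (a *: u) w = a *: br u w.
Proof. by have [Hl _] := br_lie; rewrite -[a *: u]addr0 Hl br0l addr0. Qed.

Lemma brZr a u w : br w (a *: u) = a *: br w u.
Proof. by rewrite brC brZl -scalerN -brC. Qed.

Lemma brNl u v : br (- u) v = - br u v.
Proof. by rewrite -scaleN1r brZl scaleN1r. Qed.

Lemma brNr u v : br u (- v) = - br u v.
Proof. by rewrite -scaleN1r brZr scaleN1r. Qed.

Lemma br_jacobi x y u : br x (br y u) = br (br x y) u + br y (br x u).
Proof.
have [_ [_ [_ /(_ x y u)]]] := br_lie; rewrite (brC u (br x y)) (brC u x) brNr.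
by move/subr0_eq/(canRL (subrK _)).
Qed.

Lemma br_suml (I : finType) (F : I -> 'rV[R]_n) u :
  br (\sum_i F i) u = \sum_i br (F i) u.
Proof.
apply: (big_morph (fun x => br x u) (id1 := 0)); last exact: br0l.
by move=> x y; rewrite brDl.
Qed.

Lemma br_sumr (I : finType) (F : I -> 'rV[R]_n) u :
  br u (\sum_i F i) = \sum_i br u (F i).
Proof.
apply: (big_morph (br u) (id1 := 0)); last exact: br0r.
by move=> x y; rewrite brDr.
Qed.

(** Vectors are rows, so products of operators compose from left to right; hence the order of the
    factors in [ad_br]. *)
Definition ad x : 'M[R]_n := lin1_mx (br x).

Lemma mul_ad x u : u *m ad x = br x u.
Proof.
rewrite {2}[u]row_sum_delta br_sumr mulmx_sum_row; apply: eq_bigr => i _.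
by rewrite brZr; congr (_ *: _); apply/rowP => j; rewrite !mxE.
Qed.

Lemma adP (A B : 'M[R]_n) : (forall u : 'rV_n, u *m A = u *m B) -> A = B.
Proof. by move=> AB; apply/row_matrixP => i; rewrite !rowE. Qed.

Lemma adD x y : ad (x + y) = ad x + ad y.
Proof. by apply: adP => u; rewrite mulmxDr !mul_ad brDl. Qed.

Lemma adZ a x : ad (a *: x) = a *: ad x.
Proof. by apply: adP => u; rewrite -scalemxAr !mul_ad brZl. Qed.

Lemma ad_br x y : ad (br x y) = ad y *m ad x - ad x *m ad y.
Proof.
by apply: adP => u; rewrite mulmxBr !mulmxA !mul_ad (br_jacobi x y) addrK.
Qed.

Lemma mem_derived V u v : (u <= V)%MS -> (v <= V)%MS -> (br u v <= derived br V)%MS.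
Proof.
move=> /submxP[a ->] /submxP[b ->]; rewrite !mulmx_sum_row br_suml.
apply: summx_sub => i _; rewrite br_sumr; apply: summx_sub => j _.
rewrite brZl brZr !scalemx_sub //.
by apply/(sumsmx_sup i)/(sumsmx_sup j); rewrite ?genmxE.
Qed.

Lemma derived_min m V (W : 'M_(m, n)) :
  (forall u v, u <= V -> v <= V -> br u v <= W)%MS -> (derived br V <= W)%MS.
Proof.
move=> VW; apply/sumsmx_subP => i _; apply/sumsmx_subP => j _.
by rewrite genmxE VW ?row_sub.
Qed.

Lemma derivedS V U : (V <= U)%MS -> (derived br V <= derived br U)%MS.
Proof.
move=> VU; apply: derived_min => u v uV vV.
by rewrite mem_derived // (submx_trans _ VU).
Qed.

Lemma derived_ideal V x : (forall v, v <= V -> br x v <= V)%MS ->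
  forall v, (v <= derived br V -> br x v <= derived br V)%MS.
Proof.
move=> xV v; rewrite -mul_ad => vD.
(* The vectors sent by [ad x] into the derived subspace form a kernel, so it is enough to test
   brackets; there the Jacobi identity makes [br x] a derivation. *)
apply: submx_trans (submxMr _ vD) _; rewrite submxE -mulmxA.
apply/eqP/sub_kermxP/derived_min => a b aV bV.
apply/sub_kermxP/eqP; rewrite mulmxA -submxE mul_ad br_jacobi.
by rewrite addmx_sub // mem_derived // xV.
Qed.

Lemma mem_dseries1 x y : (br x y <= dseries br 1)%MS.
Proof. by apply: mem_derived; apply: submx1. Qed.

Lemma dseries2_ideal x v : (v <= dseries br 2 -> br x v <= dseries br 2)%MS.
Proof. by apply: derived_ideal => u _; apply: mem_dseries1. Qed.

Lemma dseries2_sub : (dseries br 2 <= dseries br 1)%MS.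
Proof. by apply: derived_min => u v _ _; apply: mem_dseries1. Qed.

(** Otherwise every term of the derived series would contain [G^2], by induction, and the series
    would never reach zero. *)
Lemma dseries1_not_sub2 : dseries br 2 != 0 -> lie_solvable br ->
  ~~ (dseries br 1 <= dseries br 2)%MS.
Proof.
move=> A0 [k Dk]; apply: contra A0 => NA; rewrite -submx0 -Dk.
elim: k {Dk} => [|k IHk]; first exact: submx1.
exact: derivedS (submx_trans NA IHk).
Qed.

(* [Y] lifts a basis of [G^1 / G^2] and [Z] is a basis of [G^2]; [Q] and [Q']
   read off the coordinates on [Y] and on [Z]. *)
Definition derived_basis p d (Y : 'M[R]_(p, n)) (Z : 'M[R]_(d, n))
    (Q : 'M[R]_(n, p)) (Q' : 'M[R]_(n, d)) : Prop :=
  [/\ (Z :=: dseries br 2)%MS, (col_mx Y Z :=: dseries br 1)%MS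
    & col_mx Y Z *m row_mx Q Q' = 1%:M].

Lemma ex_derived_basis : exists p d (Y : 'M[R]_(p, n)) (Z : 'M[R]_(d, n)) Q Q',
  derived_basis Y Z Q Q'.
Proof.
set N := dseries br 1; set A := dseries br 2.
pose Y := row_base (N :\: A)%MS; pose Z := row_base A.
have eYZ : (col_mx Y Z :=: N)%MS.
  apply: eqmx_trans (eqmx_sym (addsmxE _ _)) _.
  apply: eqmx_trans (adds_eqmx (eq_row_base _) (eq_row_base _)) _.
  apply: eqmx_trans (addsmx_diff_cap_eq N A).
  by apply: adds_eqmx (eqmx_sym (capmx_idPr _)) => //; apply: dseries2_sub.
have fYZ : row_free (col_mx Y Z).
  rewrite /row_free -addsmxE mxrank_disjoint_sum ?eq_row_base //.
  apply/eqP; rewrite -submx0 -(capmx_diff N A) capmxS ?eq_row_base //.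
exists _, _, Y, Z, (lsubmx (pinvmx (col_mx Y Z))), (rsubmx (pinvmx (col_mx Y Z))).
by split=> //; [apply: eq_row_base | rewrite hsubmxK mulmxVp].
Qed.

End LieAlgebra.

(** * The adjoint action on [G^1] in block form, and the radicals of functionals vanishing on
    [G^2] *)

Section DerivedBasis.
Variables (R : fieldType) (n : nat) (br : 'rV[R]_n -> 'rV[R]_n -> 'rV[R]_n).
Hypothesis br_lie : is_lie br.
Variables (p d : nat) (Y : 'M[R]_(p, n)) (Z : 'M[R]_(d, n)).
Variables (Q : 'M[R]_(n, p)) (Q' : 'M[R]_(n, d)).
Hypothesis YZ : derived_basis br Y Z Q Q'.
Implicit Types (x y u v : 'rV[R]_n).
Local Notation ad := (ad br).

Lemma dual_basis : [/\ Y *m Q = 1%:M, Y *m Q' = 0, Z *m Q = 0 & Z *m Q' = 1%:M].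
Proof.
have [_ _] := YZ; rewrite mul_col_row scalar_mx_block.
by case/eq_block_mx.
Qed.
Let YQ : Y *m Q = 1%:M. Proof. by case: dual_basis. Qed.
Let ZQ : Z *m Q = 0. Proof. by case: dual_basis. Qed.
Let ZQ' : Z *m Q' = 1%:M. Proof. by case: dual_basis. Qed.

Lemma subY : (Y <= dseries br 1)%MS.
Proof.
have [_ <- _] := YZ; apply: submx_trans (_ : Y <= Y + Z)%MS _.
  exact: addsmxSl.
by rewrite addsmxE.
Qed.

Lemma subZ : (Z <= dseries br 2)%MS. Proof. by have [-> _ _] := YZ. Qed.

Lemma derived_coord m (V : 'M_(m, n)) :
  (V <= dseries br 1)%MS -> V = V *m Q *m Y + V *m Q' *m Z.
Proof.
have [_ <- YZ1] := YZ => /submxP[W ->].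
by rewrite -!mulmxA -!mulmxDr -mul_row_col !mulmxA -[W *m _ *m _]mulmxA YZ1 mulmx1.
Qed.

Lemma derived2_coord m (V : 'M_(m, n)) :
  (V <= dseries br 2)%MS -> V *m Q = 0 /\ V = V *m Q' *m Z.
Proof.
have [<- _ _] := YZ => /submxP[W ->].
by split; [rewrite -mulmxA ZQ mulmx0 | rewrite -[W *m _ *m Q']mulmxA ZQ' mulmx1].
Qed.

Lemma derived2P m (V : 'M_(m, n)) :
  (V <= dseries br 1)%MS -> V *m Q = 0 -> V = V *m Q' *m Z.
Proof. by move=> VN VQ; rewrite {1}(derived_coord VN) VQ mul0mx add0r. Qed.

(* Matrix blocks of [ad x] on [G^1] for the bases [Y], [Z]: the action on
   [G^1 / G^2], the action on [G^2], and the remaining off-diagonal block. *)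
Definition quot_ad x : 'M[R]_p := Y *m ad x *m Q.
Definition derived2_ad x : 'M[R]_d := Z *m ad x *m Q'.
Definition mixed_ad x : 'M[R]_(p, d) := Y *m ad x *m Q'.

Lemma sub_ad m (V : 'M_(m, n)) (W : 'M[R]_n) x :
  (forall v, v <= V -> br x v <= W)%MS -> (V *m ad x <= W)%MS.
Proof.
by move=> VW; apply/row_subP => i; rewrite row_mul mul_ad // VW ?row_sub.
Qed.

Lemma Y_ad x : Y *m ad x = quot_ad x *m Y + mixed_ad x *m Z.
Proof. by apply: derived_coord; apply: sub_ad => v _; apply: mem_dseries1. Qed.

Lemma Z_ad x : Z *m ad x = derived2_ad x *m Z.
Proof.
apply: (derived2_coord _).2; apply: sub_ad => v vZ.
by apply: (dseries2_ideal br_lie); apply: submx_trans vZ subZ.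
Qed.

Lemma Z_ad_Q x : Z *m ad x *m Q = 0.
Proof. by rewrite Z_ad -mulmxA ZQ mulmx0. Qed.

Lemma quot_ad_br x y : quot_ad (br x y) = quot_ad y *m quot_ad x - quot_ad x *m quot_ad y.
Proof.
have H u v : Y *m ad u *m ad v *m Q = quot_ad u *m quot_ad v.
  rewrite Y_ad !mulmxDl -!(mulmxA (mixed_ad u)) Z_ad_Q mulmx0 addr0.
  by rewrite -!(mulmxA (quot_ad u)).
by rewrite -!H /quot_ad ad_br // mulmxBr mulmxBl !mulmxA.
Qed.

Lemma derived2_ad_br x y :
  derived2_ad (br x y) = derived2_ad y *m derived2_ad x - derived2_ad x *m derived2_ad y.
Proof.
have H u v : Z *m ad u *m ad v *m Q' = derived2_ad u *m derived2_ad v.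
  by rewrite Z_ad -!(mulmxA (derived2_ad u)).
by rewrite -!H /derived2_ad ad_br // mulmxBr mulmxBl !mulmxA.
Qed.

Lemma quot_ad_derived x : (x <= dseries br 1)%MS -> quot_ad x = 0.
Proof.
move=> xN; apply: (derived2_coord _).1; apply: sub_ad => v vY.
by apply: (mem_derived br_lie xN); apply: submx_trans vY subY.
Qed.

Lemma quot_ad_comm x y : quot_ad x *m quot_ad y = quot_ad y *m quot_ad x.
Proof.
by apply/esym/subr0_eq; rewrite -quot_ad_br quot_ad_derived // mem_dseries1.
Qed.

Lemma quot_adD x y : quot_ad (x + y) = quot_ad x + quot_ad y.
Proof. by rewrite /quot_ad adD // mulmxDr mulmxDl. Qed.

Lemma quot_adZ a x : quot_ad (a *: x) = a *: quot_ad x.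
Proof. by rewrite /quot_ad adZ // -scalemxAr -scalemxAl. Qed.

Lemma derived2_adD x y : derived2_ad (x + y) = derived2_ad x + derived2_ad y.
Proof. by rewrite /derived2_ad adD // mulmxDr mulmxDl. Qed.

Lemma derived2_adZ a x : derived2_ad (a *: x) = a *: derived2_ad x.
Proof. by rewrite /derived2_ad adZ // -scalemxAr -scalemxAl. Qed.

Lemma quot_ad_sum x : quot_ad x = \sum_i x 0 i *: quot_ad (delta_mx 0 i).
Proof.
rewrite {1}[x]row_sum_delta; under [RHS]eq_bigr do rewrite -quot_adZ.
apply: (big_morph quot_ad (id1 := 0)); first exact: quot_adD.
by rewrite -(scale0r (0 : 'rV_n)) quot_adZ scale0r.
Qed.

Lemma derived2_ad_derived2 x : commutative_sub br (dseries br 2) ->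
  (x <= dseries br 2)%MS -> derived2_ad x = 0.
Proof.
move=> Acomm xA; suff ZA : Z *m ad x = 0 by rewrite /derived2_ad ZA mul0mx.
apply/row_matrixP => i; rewrite row_mul mul_ad // row0.
by apply: Acomm => //; apply: submx_trans (row_sub _ _) subZ.
Qed.

(* Stands in for the nilpotency of [G^1]. *)
Lemma mxtrace_derived2_ad x : (x <= dseries br 1)%MS -> \tr (derived2_ad x) = 0.
Proof.
move=> xN.
(* The trace as a functional on the whole algebra: brackets act by commutators, so it vanishes on
   all brackets and therefore on [G^1]. *)
pose t : 'cV[R]_n := \col_i \tr (derived2_ad (delta_mx 0 i)).
have tE y : y *m t = (\tr (derived2_ad y))%:M.
  apply/rowP => i; rewrite !mxE ord1 mulr1n [in RHS](row_sum_delta y).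
  rewrite (big_morph derived2_ad (id1 := 0) (op1 := +%R)); last first.
  - by rewrite -(scale0r (0 : 'rV_n)) derived2_adZ scale0r.
  - exact: derived2_adD.
  by rewrite linear_sum; apply: eq_bigr => j _; rewrite derived2_adZ linearZ !mxE.
suff: x *m t = 0 by rewrite tE => /rowP/(_ 0); rewrite !mxE mulr1n.
apply/sub_kermxP; apply: submx_trans xN _; apply: derived_min => u v _ _.
apply/sub_kermxP; rewrite tE derived2_ad_br linearB /= mxtrace_mulC subrr.
by apply/matrixP => i j; rewrite !mxE mul0rn.
Qed.

Section MD.
Hypothesis n_ge2 : (2 <= n)%N.
Hypothesis MD : is_MD (n - 2) br.

(* [Q *m f] runs over the functionals on [G^1] that vanish on [G^2]. *)
Lemma corank_orbit (f : 'cV[R]_p) m (K : 'M[R]_(m, n)) :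
  f != 0 -> (forall x, K *m ad x *m (Q *m f) = 0) -> (\rank K <= 2)%N.
Proof.
move=> f0 Kf; have [_ /(_ (Q *m f))] := MD.
rewrite /nontrivial_orbit /coadj_orbit_dim; set O := orbit_matrix _ _ => rO.
have KO : K *m O = 0.
  apply/matrixP => i j; transitivity (col j (K *m O) i 0); first by rewrite [RHS]mxE.
  have -> : col j (K *m O) = K *m col j O by rewrite !colE mulmxA.
  have -> : col j O = - (ad (delta_mx 0 j) *m (Q *m f)).
    apply/colP => k; rewrite mxE [O k j]mxE [RHS]mxE brC // mulNmx [LHS]mxE.
    by rewrite -mul_ad // -mulmxA -rowE mxE.
  by rewrite mulmxN (mulmxA K) Kf !mxE oppr0.
have := mulmx0_rank_max KO; rewrite rO; first by lia.
apply: contraNneq f0 => NQf; rewrite -[f]mul1mx -YQ -mulmxA.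
by have /submxP[D ->] := subY; rewrite -mulmxA NQf mulmx0.
Qed.

(** The radical of [Q *m f] contains [G^2], because brackets with [Z] stay in [G^2], where the
    functional vanishes; the rows of [C *m Y] lie in it too and are independent of [Z] up to the
    rank of [C]. *)
Lemma corank_quot_ad (f : 'cV[R]_p) m (C : 'M[R]_(m, p)) :
  f != 0 -> (forall x, C *m (quot_ad x *m f) = 0) -> (\rank C + d <= 2)%N.
Proof.
move=> f0 Cf; have := @corank_orbit f _ (col_mx (C *m Y) Z) f0.
have -> : col_mx (C *m Y) Z = block_mx C 0 0 1%:M *m col_mx Y Z.
  by rewrite mul_block_col !mul0mx mul1mx addr0 add0r.
rewrite mxrankMfree; last by have [_ _ H] := YZ; apply/row_freeP; exists (row_mx Q Q').
rewrite rank_diag_block_mx mxrank1; apply=> x.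
rewrite mul_block_col !mul0mx mul1mx addr0 add0r !mul_col_mx.
rewrite [Z *m _ *m _]mulmxA Z_ad_Q mul0mx.
have -> : C *m Y *m ad x *m (Q *m f) = C *m (quot_ad x *m f) by rewrite /quot_ad !mulmxA.
by rewrite Cf col_mx0.
Qed.
End MD.

Lemma derived2_rank : \rank (dseries br 2) = d.
Proof.
have [<- _ H] := YZ; apply/eqP; rewrite -[_ == _]/(row_free Z).
by apply/row_freeP; exists Q'; have [] := dual_basis.
Qed.

Lemma derived_basis_pos : dseries br 2 != 0 -> lie_solvable br ->
  (0 < p)%N && (0 < d)%N.
Proof.
move=> A0 sol; rewrite -derived2_rank !lt0n mxrank_eq0 A0 andbT.
apply: contra (dseries1_not_sub2 br_lie A0 sol) => /eqP p0.
rewrite (derived_coord (submx_refl _)).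
have -> : dseries br 1 *m Q = 0.
  by apply/matrixP => i j; have : (j < 0)%N by rewrite -p0.
by rewrite mul0mx add0r mulmx_sub // subZ.
Qed.

(** A commuting [B] that kills [f] kills all [quot_ad x *m f], and nondegeneracy says that these
    span the whole space. *)
Lemma quot_ad_annihilator (f : 'cV[R]_p) (B : 'M[R]_p) :
  (forall u : 'rV_p, (forall x, u *m (quot_ad x *m f) = 0) -> u = 0) ->
  (forall x, B *m quot_ad x = quot_ad x *m B) -> B *m f = 0 -> B = 0.
Proof.
move=> nondeg BC Bf; apply/row_matrixP => i; rewrite row0; apply: nondeg => x.
by rewrite -row_mul mulmxA BC -mulmxA Bf mulmx0 row0.
Qed.

(** The vectors [quot_ad x *m f] fill the whole space, so some [w] fixes [f]; then
    [quot_ad w - 1%:M] commutes with all the operators and kills [f]. *)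
Lemma ex_quot_ad_id : (0 < p)%N ->
  (forall f : 'cV[R]_p, f != 0 -> forall u : 'rV_p,
     (forall x, u *m (quot_ad x *m f) = 0) -> u = 0) ->
  exists x, quot_ad x = 1%:M.
Proof.
move=> p_gt0 nondeg; pose f : 'cV[R]_p := const_mx 1.
have f0 : f != 0.
  by apply/matrix0Pn; exists (Ordinal p_gt0), 0; rewrite mxE oner_eq0.
pose D : 'M_(n, p) := \matrix_i (quot_ad (delta_mx 0 i) *m f)^T.
have /submxP[w fw] : (f^T <= D)%MS.
  apply: submx_full; rewrite /row_full -mxrank_tr -[_ == _]/(row_free D^T).
  apply: inj_row_free => u uD; apply: (nondeg f f0) => x.
  rewrite quot_ad_sum mulmx_suml mulmx_sumr big1 // => i _.
  rewrite -scalemxAl -scalemxAr.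
  suff -> : quot_ad (delta_mx 0 i) *m f = D^T *m delta_mx i 0.
    by rewrite mulmxA uD mul0mx scaler0.
  by rewrite -colE -tr_row rowK trmxK.
have wf : quot_ad w *m f = f.
  apply: trmx_inj; rewrite fw mulmx_sum_row quot_ad_sum mulmx_suml linear_sum.
  by apply: eq_bigr => i _; rewrite rowK -scalemxAl linearZ.
exists w; apply/subr0_eq/(quot_ad_annihilator (nondeg f f0)) => [x|].
  by rewrite mulmxBl mulmxBr quot_ad_comm mul1mx mulmx1.
by rewrite mulmxBl wf mul1mx subrr.
Qed.

Lemma br_mulY x (w : 'rV_p) :
  br x (w *m Y) = w *m quot_ad x *m Y + w *m mixed_ad x *m Z.
Proof. by rewrite -mul_ad // -mulmxA Y_ad mulmxDr !mulmxA. Qed.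

Lemma br_mulZ x (w : 'rV_d) : br x (w *m Z) = w *m derived2_ad x *m Z.
Proof. by rewrite -mul_ad // -mulmxA Z_ad mulmxA. Qed.

Hypothesis Acomm : commutative_sub br (dseries br 2).

Lemma br_derived u v : (u <= dseries br 1)%MS -> (v <= dseries br 1)%MS ->
  br u v = br (u *m Q *m Y) (v *m Q *m Y)
         + v *m Q' *m derived2_ad (u *m Q *m Y) *m Z
         - u *m Q' *m derived2_ad (v *m Q *m Y) *m Z.
Proof.
move=> /derived_coord uE /derived_coord vE.
rewrite -(br_mulZ _ (v *m Q')) -(br_mulZ _ (u *m Q')).
move: (u *m Q *m Y) (v *m Q *m Y) uE vE => uY vY uE vE.
have ZA (w : 'rV_d) : (w *m Z <= dseries br 2)%MS.
  exact: submx_trans (submxMl _ _) subZ.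
have -> : br u v = br (uY + u *m Q' *m Z) (vY + v *m Q' *m Z) by rewrite -uE -vE.
rewrite (brDl br_lie) !(brDr br_lie) (Acomm (ZA _) (ZA _)) addr0; congr (_ + _).
exact: (brC br_lie).
Qed.

(** Modulo [G^2] the argument on the left is [br x (w *m Y)], and [G^2] acts on itself by zero.
    Consequently the [w] for which [w *m Y] acts by zero on [G^2] form a submodule. *)
Lemma derived2_ad_mulY_quot_ad x (w : 'rV_p) :
  derived2_ad (w *m quot_ad x *m Y) =
    derived2_ad (w *m Y) *m derived2_ad x - derived2_ad x *m derived2_ad (w *m Y).
Proof.
rewrite -derived2_ad_br br_mulY derived2_adD.
rewrite (derived2_ad_derived2 Acomm (submx_trans (submxMl _ _) subZ)).
by rewrite addr0.
Qed.

Lemma derived2_ad_mulY_sum (w : 'rV_p) :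
  derived2_ad (w *m Y) = \sum_i w 0 i *: derived2_ad (row i Y).
Proof.
rewrite mulmx_sum_row (big_morph derived2_ad (id1 := 0) (op1 := +%R)).
- by apply: eq_bigr => i _; rewrite derived2_adZ.
- exact: derived2_adD.
by rewrite -(scale0r (0 : 'rV_n)) derived2_adZ scale0r.
Qed.

Lemma mulY_sub (w : 'rV_p) : (w *m Y <= dseries br 1)%MS.
Proof. exact: submx_trans (submxMl _ _) subY. Qed.

(* [T = T X - X T] with [T] invertible would make [X] and [X - 1] conjugate. *)
Lemma derived2_ad_mulY_nunit x (w : 'rV_p) : d%:R != 0 :> R -> quot_ad x = 1%:M ->
  derived2_ad (w *m Y) \notin unitmx.
Proof.
move=> d0 x1; apply: contra d0 => uT.
have := derived2_ad_mulY_quot_ad x w; rewrite x1 mulmx1; set T := derived2_ad _.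
move/(congr1 (mulmx (invmx T))); rewrite mulmxBr mulVmx // mulmxA mulVmx // mul1mx.
move/(congr1 mxtrace); rewrite mxtrace1 linearB /= [\tr (invmx T *m _)]mxtrace_mulC.
by rewrite -mulmxA mulmxV // mulmx1 subrr => ->.
Qed.

End DerivedBasis.

(** * The dimensions of [G^1 / G^2] and [G^2] *)

Section DerivedSize.
Variables (R : rcfType) (n : nat) (br : 'rV[R]_n -> 'rV[R]_n -> 'rV[R]_n).
Hypothesis br_lie : is_lie br.
Hypothesis Acomm : commutative_sub br (dseries br 2).
Hypotheses (n_ge2 : (2 <= n)%N) (MD : is_MD (n - 2) br).

(** Since [d] is positive, [corank_quot_ad] leaves rank at most 1 for [C], as
    [commuting_corank_le1_size] requires; taking [C = 0] bounds [d]. *)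
Lemma derived_basis_size p d (Y : 'M[R]_(p, n)) (Z : 'M[R]_(d, n)) Q Q' :
  dseries br 2 != 0 -> derived_basis br Y Z Q Q' ->
  ((0 < p <= 2) && (0 < d <= 2))%N.
Proof.
move=> A0 YZ; have /andP[p_gt0 d_gt0] := derived_basis_pos br_lie YZ A0 MD.1.
rewrite p_gt0 d_gt0 /=; apply/andP; split.
  apply: (commuting_corank_le1_size (M := fun i => quot_ad br Y Q (delta_mx 0 i))).
    by move=> i j; apply: (quot_ad_comm br_lie YZ).
  move=> f f0 C Cf; suff: (\rank C + d <= 2)%N by lia.
  apply: (corank_quot_ad br_lie YZ n_ge2 MD f0) => x.
  rewrite (quot_ad_sum br_lie) mulmx_suml mulmx_sumr big1 // => i _.
  by rewrite -scalemxAl -scalemxAr Cf scaler0.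
pose f : 'cV[R]_p := const_mx 1.
have f0 : f != 0.
  by apply/matrix0Pn; exists (Ordinal p_gt0), 0; rewrite mxE oner_eq0.
have := @corank_quot_ad _ _ _ br_lie _ _ _ _ _ _ YZ n_ge2 MD f 1 0 f0.
by rewrite mxrank0; apply=> x; rewrite mul0mx.
Qed.

Lemma br_derived_mulY (Y : 'M[R]_(2, n)) (u v : 'rV_2) :
  br (u *m Y) (v *m Y) = (u 0 0 * v 0 1 - u 0 1 * v 0 0) *: br (row 0 Y) (row 1 Y).
Proof.
rewrite !mulmx_sum_row !sum_ord2 !(brDl br_lie) !(brDr br_lie).
rewrite !(brZl br_lie) !(brZr br_lie) !(brxx br_lie) (brC br_lie (row 1 Y)).
by rewrite !scaler0 add0r addr0 !scalerN !scalerA -scalerBl.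
Qed.

Lemma br_derived_mulY1 (Y : 'M[R]_(1, n)) (u v : 'rV_1) :
  br (u *m Y) (v *m Y) = 0.
Proof.
rewrite [u]mx11_scalar [v]mx11_scalar !mul_scalar_mx.
by rewrite (brZl br_lie) (brZr br_lie) (brxx br_lie) !scaler0.
Qed.

(** With [d = 2] the radicals are exhausted by [G^2], so the action on [G^1 / G^2] is nondegenerate
    and some [x1] acts there as the identity. Every [T w] is then singular, and [G^1] has too few
    brackets to span a plane. *)
Lemma derived_dim_neq2 p (Y : 'M[R]_(p, n)) (Z : 'M[R]_(2, n)) Q Q' :
  (0 < p <= 2)%N -> derived_basis br Y Z Q Q' -> False.
Proof.
move=> /andP[p_gt0 p_le2] YZ.
have rA := derived2_rank YZ.
have nondeg (f : 'cV_p) : f != 0 -> forall u : 'rV_p,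
    (forall x, u *m (quot_ad br Y Q x *m f) = 0) -> u = 0.
  move=> f0 u /(corank_quot_ad br_lie YZ n_ge2 MD f0) ru.
  by apply/eqP; rewrite -mxrank_eq0; lia.
have [x1 x1E] := ex_quot_ad_id br_lie YZ p_gt0 nondeg.
pose T (w : 'rV_p) := derived2_ad br Z Q' (w *m Y).
have T_nunit w : T w \notin unitmx.
  by apply: (derived2_ad_mulY_nunit br_lie YZ Acomm _ _ x1E); rewrite pnatr_eq0.
have TE w : T w = \sum_i w 0 i *: derived2_ad br Z Q' (row i Y).
  exact: (derived2_ad_mulY_sum br_lie).
(* By [br_derived], a space containing the brackets of [Y] and the images of all [T a] contains
   [G^2], whose rank is 2. *)
have AE m (W : 'M_(m, n)) : (forall a b : 'rV_p, br (a *m Y) (b *m Y) <= W)%MS ->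
    (forall (a : 'rV_p) (c : 'rV_2), c *m T a *m Z <= W)%MS -> (2 <= \rank W)%N.
  move=> W1 W2; rewrite -rA; apply/mxrankS/derived_min => u v uN vN.
  by rewrite (br_derived br_lie YZ Acomm uN vN) !addmx_sub ?eqmx_opp ?W1 ?W2.
have [p1 | p2] : p = 1%N \/ p = 2%N by lia.
  subst p; have : (2 <= \rank (T 1%:M *m Z)%MS)%N.
    apply: AE => [a b | a c]; first by rewrite br_derived_mulY1 sub0mx.
    have -> : T a = a 0 0 *: T 1%:M by rewrite !TE !big_ord1 mxE scale1r.
    by rewrite -scalemxAr -scalemxAl scalemx_sub // -mulmxA submxMl.
  move/leq_trans/(_ (mxrankM_maxl _ _)) => rT.
  have := T_nunit 1%:M; rewrite -row_free_unit /row_free eqn_leq rT andbT.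
  by rewrite rank_leq_row.
subst p; pose S i := derived2_ad br Z Q' (row i Y).
have TE2 w : T w = w 0 0 *: S 0 + w 0 1 *: S 1.
  by rewrite TE sum_ord2.
have [||a b | u u0] := @traceless_singular_dependent _ (S 0) (S 1).
- by apply: (mxtrace_derived2_ad br_lie YZ); apply: submx_trans (row_sub _ _) (subY YZ).
- by apply: (mxtrace_derived2_ad br_lie YZ); apply: submx_trans (row_sub _ _) (subY YZ).
- by have := T_nunit (\row_i (if i == 0 then a else b)); rewrite TE2 !mxE.
rewrite -TE2 => Tu.
(* The kernel of [T] is a nonzero submodule, so it is everything. *)
have T0 w : T w = 0.
  apply/matrixP => i j; rewrite [RHS]mxE; apply/eqP/contraT => Tw; case/eqP: u0.
  pose f : 'cV_2 := \col_k S k i j.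
  have fE v : (v *m f) 0 0 = T v i j.
    by rewrite TE summxE mxE; apply: eq_bigr => k _; rewrite !mxE.
  have f0 : f != 0 by apply: contraNneq Tw => f0; rewrite -fE f0 mulmx0 mxE.
  apply: (nondeg f f0) => x; rewrite mulmxA; apply/matrixP => k l; rewrite !ord1 fE.
  rewrite /T (derived2_ad_mulY_quot_ad br_lie YZ Acomm) -/(T u) Tu.
  by rewrite mul0mx mulmx0 subrr !mxE.
have : (2 <= \rank (br (row 0%R Y) (row 1%R Y)))%N.
  apply: AE => [a b | a c]; first by rewrite br_derived_mulY scalemx_sub.
  by rewrite T0 mulmx0 mul0mx sub0mx.
by rewrite leqNgt ltnS rank_leq_row.
Qed.

Lemma derived_basis_dims p d (Y : 'M[R]_(p, n)) (Z : 'M[R]_(d, n)) Q Q' :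
  dseries br 2 != 0 -> derived_basis br Y Z Q Q' -> p = 2 /\ d = 1%N.
Proof.
move=> A0 YZ; have /andP[p_bnd d_bnd] := derived_basis_size A0 YZ.
have [d1 | d2] : d = 1%N \/ d = 2 by lia.
  split=> //; have [p1 | //] : p = 1%N \/ p = 2 by lia.
  subst p d; case/negP: A0; rewrite -submx0; apply: derived_min => u v uN vN.
  (* A traceless matrix of size 1 is zero; with [p = 1] this makes [G^1] commutative, against
     [A0]. *)
  have act2_0 (w : 'rV_1) : derived2_ad br Z Q' (w *m Y) = 0.
    rewrite [LHS]mx11_scalar -trace_mx11.
    by rewrite (mxtrace_derived2_ad br_lie YZ (mulY_sub YZ w)) raddf0.
  rewrite (br_derived br_lie YZ Acomm uN vN) br_derived_mulY1 !act2_0.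
  by rewrite !mulmx0 !mul0mx subr0 addr0 sub0mx.
by subst d; case: (derived_dim_neq2 p_bnd YZ).
Qed.
End DerivedSize.

(** * Recognizing the target algebra from its relations *)

Section S545.
Variables (R : fieldType) (n : nat) (br : 'rV[R]_n -> 'rV[R]_n -> 'rV[R]_n).
Hypothesis br_lie : is_lie br.
Variables k x1 x2 y1 y2 z : 'rV[R]_n.
Hypotheses (x1k : br x1 k = 0) (x2k : br x2 k = 0).
Hypotheses (y1k : br y1 k = 0) (y2k : br y2 k = 0) (zk : br z k = 0).
Hypotheses (x1x2 : br x1 x2 = 0) (x1y1 : br x1 y1 = y1) (x1y2 : br x1 y2 = y2).
Hypotheses (x1z : br x1 z = 2 *: z) (x2y1 : br x2 y1 = y2) (x2y2 : br x2 y2 = - y1).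
Hypotheses (x2z : br x2 z = 0) (y1y2 : br y1 y2 = z) (y1z : br y1 z = 0) (y2z : br y2 z = 0).

Let B : 'M[R]_(5, n) := \matrix_(i < 5) nth 0 [:: x1; x2; y1; y2; z] i.

Lemma s545_const_mulmx i j : s545_const R i j *m B = br (row i B) (row j B).
Proof.
have e5E t : (t < 5)%N -> e5 R t *m B = nth 0 [:: x1; x2; y1; y2; z] t.
  by move=> t5; rewrite -rowE rowK inordK.
have x := ((x1x2, x1y1, x1y2, x1z), (x2y1, x2y2, x2z), (y1y2, y1z, y2z), brxx br_lie).
rewrite !rowK; case: i j => [[|[|[|[|[|//]]]]] ?] [[|[|[|[|[|//]]]]] ?];
  rewrite /s545_const /= ?mulNmx -?scalemxAl ?e5E //= ?mul0mx ?x //;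
  by rewrite (brC br_lie) x ?oppr0 ?opprK.
Qed.

Lemma br_mul_col (u v : 'rV[R]_(1 + 5)) :
  br (u *m col_mx k B) (v *m col_mx k B) = lie_sum_R (@s545 R) u v *m col_mx k B.
Proof.
have kCr (w : 'rV_5) : br (w *m B) k = 0.
  rewrite mulmx_sum_row (br_suml br_lie) big1 // => i _; rewrite (brZl br_lie) rowK.
  by case: i => [[|[|[|[|[|//]]]]] ?]; rewrite /= ?x1k ?x2k ?y1k ?y2k ?zk scaler0.
have kC (w : 'rV_5) : br k (w *m B) = 0 by rewrite (brC br_lie) kCr oppr0.
rewrite /lie_sum_R mul_row_col mul0mx add0r -{1}[u]hsubmxK -{1}[v]hsubmxK !mul_row_col.
rewrite (brDl br_lie) !(brDr br_lie _ (lsubmx v *m k)).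
rewrite [lsubmx u]mx11_scalar [lsubmx v]mx11_scalar !mul_scalar_mx.
rewrite !(brZl br_lie) !(brZr br_lie) !kC !kCr (brxx br_lie) !scaler0 !add0r.
rewrite (mulmx_sum_row (rsubmx u)) (mulmx_sum_row (rsubmx v)) (br_suml br_lie).
rewrite /s545 /bracket_of mulmx_suml.
apply: eq_bigr => i _; rewrite (br_sumr br_lie) mulmx_suml; apply: eq_bigr => j _.
by rewrite (brZl br_lie) (brZr br_lie) scalerA -scalemxAl s545_const_mulmx.
Qed.

Hypotheses (z0 : z != 0) (kz : ~~ (k <= z)%MS).

(** [y1] and [y2] commute with [k], so they kill the rest of a vanishing combination. Double
    brackets with them isolate the coefficients of [x1] and [x2], single brackets those of [y1] and
    [y2]; what remains is a relation between [k] and [z]. *)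
Lemma col_mx_free : row_free (col_mx k B).
Proof.
apply: inj_row_free => u; rewrite -[u]hsubmxK; move: (lsubmx u) (rsubmx u) => {u} a v.
rewrite mul_row_col => uB.
have bE w : br w k = 0 -> br w (v *m B) = 0.
  move=> wk; rewrite -[v *m B](addKr (a *m k)) uB addr0 (brNr br_lie) [a]mx11_scalar mul_scalar_mx.
  by rewrite (brZr br_lie) wk scaler0 oppr0.
have [e eE] : exists e : nat -> R, forall i : 'I_5, v 0 i = e i.
  by exists (fun t => v 0 (inord t)) => i; rewrite inord_val.
have vB : v *m B = e 0%N *: x1 + e 1%N *: x2 + e 2 *: y1 + e 3 *: y2 + e 4 *: z.
  rewrite mulmx_sum_row; under eq_bigr do rewrite rowK eE.
  by rewrite !big_ord_recl big_ord0 /= addr0 !addrA.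
have zI c : c *: z = 0 -> c = 0.
  by move/eqP; rewrite scaler_eq0 (negPf z0) orbF => /eqP.
have brE := (brDr br_lie, brZr br_lie, brNr br_lie).
have x := (x1y1, x1y2, x2y1, x2y2, y1y2, y1z, y2z, brxx br_lie).
have [y1x1 y1x2 y2x1 y2x2 y2y1] : [/\ br y1 x1 = - y1, br y1 x2 = - y2,
    br y2 x1 = - y2, br y2 x2 = y1 & br y2 y1 = - z].
  by split; rewrite (brC br_lie) x ?opprK.
have b1 : br y1 (v *m B) = - (e 0%N *: y1) - e 1%N *: y2 + e 3 *: z.
  by rewrite vB !brE y1x1 y1x2 !x !scaler0 !scalerN !addr0.
have b2 : br y2 (v *m B) = - (e 0%N *: y2) + e 1%N *: y1 - e 2 *: z.
  by rewrite vB !brE y2x1 y2x2 y2y1 !x !scaler0 !scalerN !addr0.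
have e0 : e 0%N = 0.
  apply: zI; transitivity (br y2 (br y1 (v *m B))); last by rewrite (bE y1 y1k) br0r.
  by rewrite b1 !brE y2y1 !x !scaler0 oppr0 !addr0 scalerN opprK.
have e1 : e 1%N = 0.
  apply: zI; apply: oppr_inj.
  transitivity (br y1 (br y1 (v *m B))); last by rewrite (bE y1 y1k) (br0r br_lie) oppr0.
  by rewrite b1 !brE !x !scaler0 oppr0 addr0 add0r.
have e2 : e 2 = 0.
  have /eqP := bE y2 y2k; rewrite b2 e0 e1 !scale0r oppr0 !add0r oppr_eq0.
  by move/eqP/zI.
have e3 : e 3 = 0.
  by apply: zI; rewrite -(bE y1 y1k) b1 e0 e1 !scale0r oppr0 !add0r.
have {}vB : v *m B = e 4 *: z by rewrite vB e0 e1 e2 e3 !scale0r !add0r.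
have a0 : a = 0.
  apply/eqP; apply: contraNT kz; rewrite [a]mx11_scalar.
  rewrite -scalemx1 scaler_eq0 negb_or => /andP[a0 _].
  rewrite -(eqmx_scale k a0) -mul_scalar_mx -mx11_scalar.
  by move/eqP: uB; rewrite addr_eq0 vB => /eqP ->; rewrite -scaleNr scalemx_sub.
have e4 : e 4 = 0 by apply: zI; rewrite -vB -uB a0 mul0mx add0r.
rewrite a0 (_ : v = 0) ?row_mx0 //; apply/rowP => i; rewrite mxE eE.
by case: i => -[|[|[|[|[|//]]]]].
Qed.

Lemma s545_isomorphic : n = 6%N -> lie_isomorphic br (lie_sum_R (@s545 R)).
Proof.
move=> n6; have Bfree := col_mx_free.
have Bfull : row_full (col_mx k B) by rewrite /row_full (eqP Bfree) n6.
exists (pinvmx (col_mx k B)); split.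
- by apply/row_freeP; exists (col_mx k B); rewrite mulVpmx.
- by apply/row_fullP; exists (col_mx k B); rewrite mulmxVp.
move=> u v; have E w : w = w *m pinvmx (col_mx k B) *m col_mx k B.
  by rewrite -mulmxA mulVpmx // mulmx1.
by rewrite {1}(E _ u) {1}(E _ v) br_mul_col -mulmxA mulmxVp // mulmx1.
Qed.
End S545.

(** * The Heisenberg case: centralizer, complex structure and adapted basis *)

Section HeisenbergDerived.
Variables (R : rcfType) (n : nat) (br : 'rV[R]_n -> 'rV[R]_n -> 'rV[R]_n).
Hypothesis br_lie : is_lie br.
Hypothesis Acomm : commutative_sub br (dseries br 2).
Hypothesis A0 : dseries br 2 != 0.
Hypotheses (n_ge6 : (6 <= n)%N) (MD : is_MD (n - 2) br).
Variables (Y : 'M[R]_(2, n)) (Z : 'M[R]_(1, n)) (Q : 'M[R]_(n, 2)) (Q' : 'M[R]_(n, 1)).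
Hypothesis YZ : derived_basis br Y Z Q Q'.
Local Notation ad := (ad br).
Local Notation act := (quot_ad br Y Q).
Local Notation act2 := (derived2_ad br Z Q').
Local Notation N := (dseries br 1).

Let n_ge2 : (2 <= n)%N. Proof. exact: leq_trans n_ge6. Qed.

(** [G^2] is now a line, where trace zero means zero: [G^2] is central in [G^1]. *)
Lemma derived2_ad_derived x : (x <= N)%MS -> act2 x = 0.
Proof.
by move=> xN; rewrite [LHS]mx11_scalar -trace_mx11 (mxtrace_derived2_ad br_lie YZ xN) raddf0.
Qed.

Lemma br_derivedE u v : (u <= N)%MS -> (v <= N)%MS ->
  br u v = ((u *m Q) 0 0 * (v *m Q) 0 1 - (u *m Q) 0 1 * (v *m Q) 0 0)
           *: br (row 0 Y) (row 1 Y).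
Proof.
move=> uN vN; rewrite (br_derived br_lie YZ Acomm uN vN) (br_derived_mulY br_lie).
rewrite !derived2_ad_derived ?(mulY_sub YZ) //.
by rewrite !mulmx0 !mul0mx subr0 addr0.
Qed.

Lemma br_Y_neq0 : br (row 0 Y) (row 1 Y) != 0.
Proof.
apply: contra A0 => /eqP Y0; rewrite -submx0; apply: derived_min => u v uN vN.
by rewrite br_derivedE // Y0 scaler0 sub0mx.
Qed.

Lemma YadP v : Y *m ad v = 0 <-> br v (row 0 Y) = 0 /\ br v (row 1 Y) = 0.
Proof.
rewrite -!(mul_ad br_lie) -!row_mul; split=> [-> | [Y0 Y1]]; first by rewrite !row0.
by apply/row_matrixP; apply: ord2P; rewrite row0.
Qed.

(** By [br_derivedE] the bracket of [G^1] is a determinant in the coordinates modulo [G^2], times a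
    nonzero vector, hence nondegenerate on [G^1 / G^2]. *)
Lemma centralizer_coord0 v : (v <= N)%MS -> Y *m ad v = 0 -> v *m Q = 0.
Proof.
move=> vN /YadP[]; have [YQ _ _ _] := dual_basis YZ.
have rN i : (row i Y <= N)%MS by apply: submx_trans (row_sub _ _) (subY YZ).
rewrite (br_derivedE vN (rN 0)) (br_derivedE vN (rN 1)) -!row_mul YQ.
move: (v *m Q) => w; rewrite !mxE /= !mulr0 !mulr1 subr0 sub0r => /eqP + /eqP.
rewrite !scaler_eq0 oppr_eq0 (negPf br_Y_neq0) !orbF => /eqP v1 /eqP v0.
by apply/rowP; apply: ord2P; rewrite [RHS]mxE.
Qed.

(** By the Jacobi identity [v] kills the bracket of the two rows of [Y], a nonzero vector of the
    line [G^2]. *)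
Lemma derived2_ad_centralizer v : Y *m ad v = 0 -> act2 v = 0.
Proof.
move=> /YadP[v0 v1]; set w := br (row 0 Y) (row 1 Y).
have vw : br v w = 0 by rewrite (br_jacobi br_lie) v0 v1 (br0l br_lie) (br0r br_lie) addr0.
have wA : (w <= dseries br 2)%MS.
  by apply: (mem_derived br_lie); apply: submx_trans (row_sub _ _) (subY YZ).
have [_ wE] := derived2_coord YZ wA.
move: vw; rewrite wE (br_mulZ br_lie YZ) [w *m Q']mx11_scalar [act2 v]mx11_scalar.
rewrite -scalar_mxM mul_scalar_mx => /eqP; rewrite scaler_eq0 mulf_eq0.
have := br_Y_neq0; rewrite -/w; case: (eqVneq ((w *m Q') 0 0) 0) => [w0 | _ w_neq0].
  by rewrite wE [w *m Q']mx11_scalar w0 mul_scalar_mx scale0r eqxx.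
case/orP=> /eqP; first by move->; rewrite raddf0.
by move=> Z0; case/eqP: w_neq0; rewrite wE Z0 mulmx0.
Qed.

(* The row space is the centralizer of [G^1]: commuting with [Y] is enough, as
   [G^2] is spanned by [br (row 0 Y) (row 1 Y)]. *)
Definition centralizer : 'M[R]_n :=
  kermx (\matrix_i mxvec (Y *m ad (delta_mx 0 i))).

Lemma mulmx_mxvec_ad v :
  v *m (\matrix_i mxvec (Y *m ad (delta_mx 0 i))) = mxvec (Y *m ad v).
Proof.
rewrite mulmx_sum_row {2}[v]row_sum_delta.
rewrite (big_morph ad (id1 := 0) (op1 := +%R)); last first.
- by rewrite -(scale0r (0 : 'rV_n)) (adZ br_lie) scale0r.
- exact: (adD br_lie).
rewrite mulmx_sumr linear_sum; apply: eq_bigr => i _.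
by rewrite rowK (adZ br_lie) -scalemxAr linearZ.
Qed.

Lemma centralizerP v : reflect (Y *m ad v = 0) (v <= centralizer)%MS.
Proof.
apply: (iffP sub_kermxP); rewrite mulmx_mxvec_ad.
  by move/(congr1 vec_mx); rewrite mxvecK linear0.
by move->; rewrite linear0.
Qed.

(** The centralizer of the ideal [G^1] is an ideal, so its brackets both centralize [G^1] and lie in
    it; [centralizer_coord0] then puts them in [G^2]. *)
Lemma centralizer_ad x : centralizer *m ad x *m Q = 0.
Proof.
apply/row_matrixP => i; rewrite row0 2!row_mul (mul_ad br_lie).
have /centralizerP := row_sub i centralizer; set u := row _ _ => uC.
apply: centralizer_coord0; first exact: mem_dseries1.
rewrite (ad_br br_lie) mulmxBr !mulmxA uC mul0mx sub0r (Y_ad br_lie YZ) mulmxDl.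
by rewrite -!mulmxA uC (Z_ad br_lie YZ) (derived2_ad_centralizer uC) mul0mx !mulmx0 addr0 oppr0.
Qed.

(** If some operator is nonscalar, all those commuting with it are affine in it; if all are scalar,
    [S = 0] serves. *)
Lemma ex_quot_ad_span : exists S, forall x, exists a b, act x = a%:M + b *: S.
Proof.
case: (boolP [forall i, is_scalar_mx (act (delta_mx 0 i))]) => [/forallP sc | ].
  exists 0 => x; exists (\sum_i x 0 i * act (delta_mx 0 i) 0 0), 0.
  rewrite scaler0 addr0 (quot_ad_sum br_lie) raddf_sum; apply: eq_bigr => i _.
  by have /is_scalar_mxP[a ->] := sc i; rewrite mxE scale_scalar_mx.
rewrite negb_forall => /existsP[i nsc]; exists (act (delta_mx 0 i)) => x.
exact: (commuting_mx2 nsc (quot_ad_comm br_lie YZ _ _)).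
Qed.

(* [Y *m ad x] is a combination of [Y], [S *m Y] and two matrices supported on
   [Z]; the latter two account for the inner derivations. *)
Lemma centralizer_rank_ge : (n - 4 <= \rank centralizer)%N.
Proof.
rewrite mxrank_ker leq_sub2l //; have [S actS] := ex_quot_ad_span.
pose e i : 'rV_(2 * n) := mxvec (delta_mx i 0 *m Z).
apply: (@leq_trans (\rank (col_mx (col_mx (mxvec Y) (mxvec (S *m Y))) (col_mx (e 0) (e 1))))).
  apply/mxrankS/row_subP => i; rewrite rowK (Y_ad br_lie YZ).
  have [a [b ->]] := actS (delta_mx 0 i); set c := mixed_ad _ _ _ _.
  have -> : c = c 0 0 *: delta_mx 0 0 + c 1 0 *: delta_mx 1 0.
    by apply/colP; apply: ord2P; rewrite !mxE /= ?mulr1 ?mulr0 ?addr0 ?add0r.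
  rewrite !mulmxDl !linearD /= mul_scalar_mx -!scalemxAl !linearZ /=.
  rewrite -addsmxE; apply: addmx_sub_adds; rewrite -addsmxE;
    apply: addmx_sub_adds; exact: scalemx_sub.
exact: rank_leq_row.
Qed.

Lemma centralizer_rank_le : (\rank centralizer <= 2)%N.
Proof.
apply: (@corank_orbit _ _ _ br_lie _ _ _ _ _ _ YZ n_ge2 MD (const_mx 1)).
  by apply/matrix0Pn; exists 0, 0; rewrite mxE oner_eq0.
by move=> x; rewrite mulmxA centralizer_ad mul0mx.
Qed.

Lemma dim_eq6 : n = 6%N.
Proof. by have := centralizer_rank_ge; have := centralizer_rank_le; lia. Qed.

Lemma centralizer_rank : \rank centralizer = 2.
Proof. by have := centralizer_rank_ge; have := centralizer_rank_le; lia. Qed.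

(** With [d = 1], [corank_quot_ad] alone would still allow rank 1. But the centralizer already fills
    the radical of [Q *m f], so [u *m Y], which also lies there, centralizes [G^1]. *)
Lemma quot_ad_nondegenerate (f : 'cV[R]_2) : f != 0 -> forall u : 'rV_2,
  (forall x, u *m (act x *m f) = 0) -> u = 0.
Proof.
move=> f0 u uf; pose K := col_mx centralizer (u *m Y).
have CK : (centralizer <= K)%MS by rewrite /K -addsmxE addsmxSl.
have rK : (\rank K <= 2)%N.
  apply: (@corank_orbit _ _ _ br_lie _ _ _ _ _ _ YZ n_ge2 MD f _ _ f0) => x.
  rewrite !mul_col_mx mulmxA centralizer_ad mul0mx.
  have -> : u *m Y *m ad x *m (Q *m f) = u *m (act x *m f) by rewrite /quot_ad !mulmxA.
  by rewrite uf col_mx0.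
have KC : (K <= centralizer)%MS.
  by rewrite -(geq_leqif (mxrank_leqif_sup CK)) centralizer_rank.
have /centralizerP : (u *m Y <= centralizer)%MS.
  by apply: submx_trans KC; rewrite /K -addsmxE addsmxSr.
move/(centralizer_coord0 (mulY_sub YZ u)).
by have [YQ _ _ _] := dual_basis YZ; rewrite -mulmxA YQ mulmx1.
Qed.

Lemma ex_quot_ad_scalar : exists x, act x = 1%:M.
Proof.
exact: (ex_quot_ad_id br_lie YZ _ quot_ad_nondegenerate).
Qed.

(** If all these entries vanished, the first basis row would annihilate every image of the second
    basis column, against nondegeneracy. *)
Lemma ex_quot_ad_nonscalar : exists x, act x 0 1 != 0.
Proof.
case: (boolP [forall i, act (delta_mx 0 i) 0 1 == 0]) => [/forallP act01 | ]; last first.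
  by rewrite negb_forall => /existsP[i i01]; exists (delta_mx 0 i).
exfalso.
have f0 : delta_mx 1 0 != 0 :> 'cV[R]_2.
  by apply/matrix0Pn; exists 1, 0; rewrite mxE oner_eq0.
have /rowP/(_ 0)/eqP : delta_mx 0 0 = 0 :> 'rV[R]_2; last by rewrite !mxE oner_eq0.
apply: (quot_ad_nondegenerate f0) => x.
apply/matrixP => i j; rewrite !ord1 mulmxA -rowE -colE (quot_ad_sum br_lie) !mxE summxE.
by rewrite big1 // => k _; rewrite mxE (eqP (act01 k)) mulr0.
Qed.

(** Subtracting half the trace times [x1] gives a traceless operator, whose square is a scalar [s].
    If [s >= 0], a real eigenvector and [quot_ad_annihilator] would make the operator scalar; so
    [s < 0], and rescaling normalizes it to [-1]. *)
Lemma ex_quot_ad_imaginary : exists x, act x *m act x = - 1%:M.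
Proof.
have [x1 x1E] := ex_quot_ad_scalar; have [x2 x2E] := ex_quot_ad_nonscalar.
pose x := x2 - ((act x2 0 0 + act x2 1 1) / 2) *: x1.
have xE : act x = act x2 - ((act x2 0 0 + act x2 1 1) / 2)%:M.
  by rewrite (quot_adD br_lie) -scaleNr (quot_adZ br_lie) x1E scaleNr scalemx1.
have x01 : act x 0 1 != 0.
  by rewrite xE; move: (act x2) x2E => S S01; rewrite !mxE subr0.
have x11 : act x 1 1 = - act x 0 0.
  by rewrite xE; move: (act x2) => S; rewrite !mxE !eqxx !mulr1n; field.
have := traceless_mx2_sqr x11; set s := _ + _ => xx.
have [s_ge0 | s_lt0] := leP 0 s.
  pose c := Num.sqrt s; have cc : c ^+ 2 = s by rewrite sqr_sqrtr.
  have := traceless_mx2_eigen x11 cc; set f : 'cV_2 := \col_i _ => xf.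
  have f0 : f != 0 by apply/matrix0Pn; exists 0, 0; rewrite mxE.
  have : act x - c%:M = 0.
    apply: (quot_ad_annihilator _ _ xf) => [|y].
      exact: (quot_ad_nondegenerate f0).
    by rewrite mulmxBl mulmxBr (quot_ad_comm br_lie YZ) mul_mx_scalar mul_scalar_mx.
  move: (act x) x01 => S S01 /matrixP/(_ 0 1)/eqP.
  by rewrite !mxE /= subr0 (negPf S01).
exists ((Num.sqrt (- s))^-1 *: x); rewrite (quot_adZ br_lie) -scalemxAl -scalemxAr xx scalerA.
rewrite -invfM -expr2 sqr_sqrtr ?oppr_ge0 ?ltW // scale_scalar_mx invrN mulNr mulVf ?lt_eqF //.
by rewrite raddfN.
Qed.

(** Elements of [G^1] act on [y1] and [y2] by arbitrary multiples of [z], so they can absorb the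
    errors [a *: z] and [b *: z] of a lift. *)
Lemma br_shift x y1 y2 z m1 m2 a b : br y1 y2 = z ->
  br x y1 = m1 + a *: z -> br x y2 = m2 + b *: z ->
  let x' := x - b *: y1 + a *: y2 in br x' y1 = m1 /\ br x' y2 = m2.
Proof.
move=> y12 xy1 xy2 x'.
rewrite !(brDl br_lie) !(brNl br_lie) !(brZl br_lie) !(brxx br_lie) xy1 xy2 y12.
rewrite (brC br_lie y2) y12 !scaler0 oppr0 !addr0.
by rewrite scalerN addrK addrK.
Qed.

Lemma s545_of_heisenberg : lie_isomorphic br (lie_sum_R (@s545 R)).
Proof.
have [x1 x1E] := ex_quot_ad_scalar; have [x2 JJ] := ex_quot_ad_imaginary.
set J := act x2 in JJ; pose e : 'rV[R]_2 := delta_mx 0 0.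
(* With this [y2], [x2] sends [y1] to [y2] and [y2] to [- y1] modulo [G^2]. *)
pose y1 := e *m Y; pose y2 := e *m J *m Y; pose z := br y1 y2.
have y1N : (y1 <= N)%MS by apply: (mulY_sub YZ).
have y2N : (y2 <= N)%MS by apply: (mulY_sub YZ).
(* Otherwise [J 0 0] would be a real square root of [-1]. This makes [y1] and [y2] independent
   modulo [G^2]. *)
have J01 : J 0 1 != 0.
  apply/eqP => J01; have /matrixP/(_ 0 0) := JJ; rewrite !mxE sum_ord2 J01 mul0r addr0 => JE.
  by have := sqr_ge0 (J 0 0); rewrite expr2 JE eqxx mulr1n; lra.
have y1E : y1 = row 0 Y by rewrite rowE.
have y2E : y2 = J 0 0 *: row 0 Y + J 0 1 *: row 1 Y.
  by rewrite /y2 -rowE mulmx_sum_row sum_ord2 !mxE.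
have zE : z = J 0 1 *: br (row 0 Y) (row 1 Y).
  by rewrite /z y1E y2E (brDr br_lie) !(brZr br_lie) (brxx br_lie) scaler0 add0r.
have z0 : z != 0.
  by rewrite zE scaler_eq0 negb_or J01 br_Y_neq0.
have zA : (z <= dseries br 2)%MS by apply: (mem_derived br_lie).
have [_ zQZ] := derived2_coord YZ zA.
have Zz (c : 'rV_1) : exists a, c *m Z = a *: z.
  have : (c *m Z <= z)%MS.
    rewrite zQZ [z *m Q']mx11_scalar mul_scalar_mx eqmx_scale ?submxMl //.
    apply: contraNneq z0 => zQ0.
    by rewrite zQZ [z *m Q']mx11_scalar zQ0 mul_scalar_mx scale0r.
  by move/sub_rVP.
have Nz y : (y <= N)%MS -> br y z = 0.
  move=> yN; rewrite zQZ (br_mulZ br_lie YZ) (derived2_ad_derived yN).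
  by rewrite mulmx0 mul0mx.
have center v : (v <= N)%MS -> br v y1 = 0 -> br v y2 = 0 -> exists c, v = c *: z.
  move=> vN vy1 vy2; have [c cE] := Zz (v *m Q').
  exists c; rewrite -cE; apply: (derived2P YZ) => //.
  apply: (centralizer_coord0 vN); apply/YadP.
  rewrite -y1E; split=> //; apply/eqP.
  move/eqP: vy2; rewrite y2E (brDr br_lie) !(brZr br_lie) -y1E vy1 scaler0 add0r.
  by rewrite scaler_eq0 (negPf J01).
have actY x (w : 'rV_2) : exists c, br x (w *m Y) = w *m act x *m Y + c *: z.
  have [c cE] := Zz (w *m mixed_ad br Y Q' x).
  by exists c; rewrite (br_mulY br_lie YZ) cE.
have [x3 [x3y1 x3y2]] : exists x, br x y1 = y1 /\ br x y2 = y2.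
  have [a Ea] := actY x1 e; have [b Eb] := actY x1 (e *m J).
  rewrite x1E mulmx1 in Ea; rewrite x1E mulmx1 in Eb.
  by exists (x1 - b *: y1 + a *: y2); apply: br_shift.
have [x4 [x4y1 x4y2]] : exists x, br x y1 = y2 /\ br x y2 = - y1.
  have [a Ea] := actY x2 e; have [b Eb] := actY x2 (e *m J).
  rewrite -/J -[e *m J *m J]mulmxA JJ mulmxN mulmx1 mulNmx in Eb.
  by exists (x2 - b *: y1 + a *: y2); apply: br_shift.
have x3z : br x3 z = 2 *: z.
  by rewrite /z (br_jacobi br_lie) x3y1 x3y2 scaler_nat.
have x4z : br x4 z = 0.
  by rewrite /z (br_jacobi br_lie) x4y1 x4y2 (brxx br_lie) (brNr br_lie) (brxx br_lie) oppr0 addr0.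
have brN x y : (br x y <= N)%MS by apply: mem_dseries1.
have br_center x y u : br x (br y u) = br y (br x u) -> br (br x y) u = 0.
  by move=> E; apply/eqP; rewrite -(subrr (br y (br x u))) -{1}E (br_jacobi br_lie) addrK.
have zy u : (u <= N)%MS -> br z u = 0 by move=> uN; rewrite (brC br_lie) Nz ?oppr0.
(* The actions of [x3] and [x4] on [y1] and [y2] commute, so their bracket is central in [G^1]. *)
have [c x34] : exists c, br x3 x4 = c *: z.
  apply: center => //; apply: br_center; first by rewrite x3y1 x4y1 x3y2.
  by rewrite x3y2 x4y2 (brNr br_lie) x3y1.
(* As [br x3 z = 2 *: z], subtracting [(c / 2) *: z] cancels [br x3 x4]; the action on [G^1] is
   unchanged. *)
pose x5 := x4 - (c / 2) *: z.
have two0 : 2 != 0 :> R by rewrite pnatr_eq0.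
have x5E u : (u <= N)%MS -> br x5 u = br x4 u.
  by move=> uN; rewrite (brDl br_lie) (brNl br_lie) (brZl br_lie) zy // scaler0 subr0.
have x35 : br x3 x5 = 0.
  rewrite (brDr br_lie) (brNr br_lie) (brZr br_lie) x34 x3z scalerA mulfVK //.
  by rewrite subrr.
(* The centralizer has rank 2, so it is not contained in the line of [z]. *)
have [k0 k0C k0z] : exists2 k, Y *m ad k = 0 & ~~ (k <= z)%MS.
  have /row_subPn[i iz] : ~~ (centralizer <= z)%MS.
    apply/negP => /mxrankS; rewrite centralizer_rank.
    by have := rank_leq_row z; lia.
  by exists (row i centralizer) => //; apply/centralizerP/row_sub.
have k0Y (w : 'rV_2) : br k0 (w *m Y) = 0.
  by rewrite -(mul_ad br_lie) -mulmxA k0C mulmx0.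
have k0z0 : br k0 z = 0 by rewrite (br_jacobi br_lie) !k0Y (br0l br_lie) (br0r br_lie) addr0.
have k0x x : exists c, br x k0 = c *: z.
  have br0 (w : 'rV_2) : br (br x k0) (w *m Y) = 0.
    apply: br_center; have [b ->] := actY x w.
    by rewrite k0Y (br0r br_lie) (brDr br_lie) k0Y (brZr br_lie) k0z0 scaler0 addr0.
  by apply: center; rewrite ?brN ?br0.
have [a x3k0] := k0x x3.
(* The same correction by half the error makes [k] commute with [x3]. *)
pose k := k0 - (a / 2) *: z.
have x3k : br x3 k = 0.
  by rewrite (brDr br_lie) (brNr br_lie) (brZr br_lie) x3k0 x3z scalerA mulfVK // subrr.
have kY u : br k (u *m Y) = 0.
  by rewrite (brDl br_lie) (brNl br_lie) (brZl br_lie) k0Y zy ?(mulY_sub YZ) // scaler0 subr0.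
have kz : br k z = 0.
  by rewrite (brDl br_lie) (brNl br_lie) (brZl br_lie) k0z0 (brxx br_lie) scaler0 subr0.
have y1z : br y1 z = 0 by apply: Nz.
have y2z : br y2 z = 0 by apply: Nz.
(* [br x5 k] is a multiple of [z], which [x3] doubles, while the Jacobi identity shows that [x3]
   kills it. *)
have x5k : br x5 k = 0.
  have [b x5kE] : exists b, br x5 k = b *: z.
    have [b Eb] := k0x x5; have zN : (z <= N)%MS by apply: brN.
    exists b; rewrite (brDr br_lie) (brNr br_lie) (brZr br_lie) Eb x5E // x4z.
    by rewrite scaler0 subr0.
  have /eqP := br_jacobi br_lie x3 x5 k.
  rewrite x35 (br0l br_lie) x3k (br0r br_lie) addr0 x5kE (brZr br_lie) x3z !scaler_eq0.
  by rewrite (negPf two0) (negPf z0) !orbF => /eqP ->; rewrite scale0r.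
apply: (@s545_isomorphic _ _ _ br_lie k x3 x5 y1 y2 z) => //; try by rewrite x5E.
- by rewrite (brC br_lie) kY oppr0.
- by rewrite (brC br_lie) kY oppr0.
- by rewrite (brC br_lie) kz oppr0.
- by rewrite x5E ?brN.
- apply: contra k0z => kz'; rewrite -[k0](subrK ((a / 2) *: z)).
  by rewrite addmx_sub ?scalemx_sub.
exact: dim_eq6.
Qed.

End HeisenbergDerived.

Theorem theorem5p1 (R : realType) (n : nat)
  (br : 'rV[R]_n -> 'rV[R]_n -> 'rV[R]_n) :
  (6 <= n)%N ->
  is_lie br ->
  two_step_solvable br ->
  is_MD (n - 2) br ->
  n = 6%N /\ lie_isomorphic br (lie_sum_R (@s545 R)).
Proof.
move=> n_ge6 br_lie [A0 Acomm] MD.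
have [p [d [Y [Z [Q [Q' YZ]]]]]] := ex_derived_basis br_lie.
have n_ge2 : (2 <= n)%N by apply: leq_trans n_ge6.
have [p2 d1] := derived_basis_dims br_lie Acomm n_ge2 MD A0 YZ; subst p d.
split; first exact: (dim_eq6 br_lie Acomm A0 n_ge6 MD YZ).
exact: (s545_of_heisenberg br_lie Acomm A0 n_ge6 MD YZ).
Qed.
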